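(* Let $r\ge2$, $\ell\ge2$. In the ring $\widehat{\mathcal{T}}_{2\ell}(A_{2r+1})$ the following hold for all $1\le a\le2r+1$, $1\le m\le2\ell-1$, $u\in\frac12\mathbb{Z}$: (1) $S^{(a)}_m(u+r+1+\ell)=(-1)^mS^{(2r+2-a)}_{2\ell-m}(u)=S^{(a)}_{2\ell-m}(u)$; (2) $S^{(a)}_m(u+2(r+1+\ell))=S^{(a)}_m(u)$.
   Context: $\widehat{\mathcal{T}}_{2\ell}(A_{2r+1})$ is the commutative ring with generators $S^{(a)}_m(u)^{\pm1}$ ($1\le a\le2r+1$, $1\le m\le2\ell-1$, $u\in\frac12\mathbb{Z}$, excluding $a=r+1$ with $m$ odd), where one sets $S^{(r+1)}_m(u)=0$ for odd $m$, with relations: $S^{(a)}_m(u-\frac12)S^{(a)}_m(u+\frac12)=S^{(a)}_{m-1}(u)S^{(a)}_{m+1}(u)+S^{(a-1)}_m(u)S^{(a+1)}_m(u)$ for all $1\le a\le2r+1$, $1\le m\le2\ell-1$, $u\in\frac12\mathbb{Z}$; $S^{(a)}_m(u)=(-1)^mS^{(2r+2-a)}_m(u)$ (quasi-symmetric condition); and on right sides $S^{(a)}_0(u)=S^{(a)}_{2\ell}(u)=S^{(0)}_m(u)=1$, $S^{(2r+2)}_m(u)=(-1)^m$. *)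

(* Defs.v *)
From mathcomp Require Import all_boot all_order all_algebra.
Set Implicit Arguments. Unset Strict Implicit. Unset Printing Implicit Defensive.
Import Order.TTheory GRing.Theory Num.Theory.
Local Open Scope ring_scope.

(* Encoding: the spectral parameter u in (1/2)Z is represented by the integer
   k = 2u, so u -/+ 1/2 becomes k -/+ 1 and u + c becomes k + 2c.
   S a m k : R stands for S^{(a)}_m(k/2) for 1 <= a <= 2r+1, 1 <= m <= 2l-1. *)

Definition Sx (R : nzRingType) (r l : nat) (S : nat -> nat -> int -> R)
    (a m : nat) (k : int) : R :=
  if (m == 0)%N || (m == (2 * l)%N) then 1
  else if a == 0%N then 1
  else if a == (2 * r + 2)%N then (-1) ^+ m
  else if (a == r.+1) && odd m then 0
  else S a m k.

Definition gen_index (r l a m : nat) : bool :=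
  [&& (1 <= a <= 2 * r + 1)%N, (1 <= m <= 2 * l - 1)%N & ~~ ((a == r.+1) && odd m)].

(* S satisfies the defining relations of T^_{2l}(A_{2r+1}) (with invertible generators). *)
Definition Tsystem (R : comUnitRingType) (r l : nat) (S : nat -> nat -> int -> R) : Prop :=
  (forall a m k, gen_index r l a m -> S a m k \is a GRing.unit) /\
  (forall a m k, (1 <= a <= 2 * r + 1)%N -> (1 <= m <= 2 * l - 1)%N ->
     Sx r l S a m (k - 1) * Sx r l S a m (k + 1)
     = Sx r l S a m.-1 k * Sx r l S a m.+1 k + Sx r l S a.-1 m k * Sx r l S a.+1 m k) /\
  (forall a m k, (1 <= a <= 2 * r + 1)%N -> (1 <= m <= 2 * l - 1)%N ->
     Sx r l S a m k = (-1) ^+ m * Sx r l S (2 * r + 2 - a) m k).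

(* Main.v *)
Require Import Defs.
From mathcomp Require Import all_boot all_order all_algebra all_fingroup.
From mathcomp Require Import ring zify.
Set Implicit Arguments. Unset Strict Implicit. Unset Printing Implicit Defensive.
Import Order.TTheory GRing.Theory Num.Theory.
Local Open Scope ring_scope.

(** Put N = 2r+2, L = 2l and T(a,m) = S^(a)_m.  Let M be the upper triangular band
matrix with M_{p,q} = T(q-p, 1) at spectral parameter p+q.  By induction on m,
T(a,m) is the m x m minor of M with consecutive rows p, p+1, .. and columns
p+a, p+a+1, ..: the Desnanot-Jacobi identity for these minors is the T-system
relation, and it determines T(a,m+1) as soon as T(a,m-1) is invertible.  The
remaining case a = r+1, m odd is where invertibility fails, but there quasi-symmetry
makes the window alternating of odd size, so its determinant vanishes.

Since T(a,L) = 1, the minors of size L+1 with 0 < a < N vanish.  Hence the rows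
0..L of M satisfy a single linear relation g, with g(L) = 1, on all columns
1..L+N-1.  Cramer's rule on the first columns gives g(m) = (-1)^m T(1,m), and on
the last columns g(L-m) = T(N-1,m) shifted by N+L.  Comparing the two yields the
half-periodicity for a = 1; the T-system, solved in the direction of a, extends it to
a <= r+1, because only divisions by T(a,m) with a <= r occur, and quasi-symmetry
covers the rest. *)

(** * Alternating determinants of odd size *)

(** Two-element orbits cancel in pairs. Fixed points get their own hypothesis because [F x = - F x]
    does not force [F x = 0] when there is 2-torsion. *)
Lemma sum_involution_anti (V : zmodType) (I : finType) (inv : I -> I) (F : I -> V) :
  involutive inv -> (forall x, F (inv x) = - F x) ->
  (forall x, inv x = x -> F x = 0) -> \sum_x F x = 0.
Proof.
move=> invK Finv Ffix.
rewrite (bigID (fun x => (enum_rank x < enum_rank (inv x))%N)) /=.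
rewrite [X in _ + X](bigID (fun x => (enum_rank (inv x) < enum_rank x)%N)) /=.
rewrite [X in _ + (_ + X)]big1 ?addr0; last first.
  move=> x /andP[]; rewrite -!leqNgt => le1 le2; apply: Ffix.
  by apply/enum_rank_inj/val_inj/eqP; rewrite eqn_leq le1 le2.
rewrite [X in _ + X](reindex_inj (inv_inj invK)) /=.
under [X in _ + X]eq_bigr do rewrite Finv.
rewrite sumrN; apply/eqP; rewrite subr_eq0; apply/eqP/eq_bigl => x.
by rewrite invK; case: ltngtP.
Qed.

(* Apply the previous lemma to the constant function 1 in F_2, where 1 = -1. *)
Lemma involution_odd_fix (I : finType) (inv : I -> I) :
  involutive inv -> odd #|I| -> exists x, inv x = x.
Proof.
move=> invK oddI; suff /existsP[x /eqP]: [exists x, inv x == x] by exists x.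
apply: contraTT oddI => /existsPn nofix.
have := @sum_involution_anti 'F_2 I inv (fun=> 1) invK.
rewrite sumr_const => /(_ _ _)/eqP.
rewrite -(dvdn_pcharf (pchar_Fp (isT : prime 2))) dvdn2; apply.
  by move=> _; apply/val_inj.
by move=> x /eqP; rewrite (negbTE (nofix x)).
Qed.

(* Transposition gives only [2 * \det A = 0]; pairing each permutation with its inverse
   also covers rings in which 2 is a zero divisor. *)
Lemma det_alternating_odd (K : comNzRingType) n (A : 'M[K]_n) : odd n ->
  (forall i, A i i = 0) -> (forall i j, A i j = - A j i) -> \det A = 0.
Proof.
move=> oddn A0 AN; apply: (@sum_involution_anti _ _ (fun s : 'S_n => s^-1)%g).
- exact: invgK.
- move=> s; rewrite odd_permV -mulrN; congr (_ * _).
  rewrite (reindex_inj (@perm_inj _ s)) /=.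
  under eq_bigr do rewrite permK AN.
  by rewrite prodrN /= card_ord -signr_odd oddn expr1 mulN1r.
(* A self-inverse [s] on a set of odd size fixes some [x], and the diagonal factor [A x x] kills its
   term. *)
- move=> s sV; have sK : involutive s by move=> x; rewrite -{1}sV permK.
  have [|x sx] := involution_odd_fix sK; first by rewrite card_ord.
  by rewrite (bigD1 x) //= sx A0 mul0r mulr0.
Qed.

(** * Cramer's rule and contiguous minors *)

(** Cramer's rule without division, so that it also applies when [\det A = 0]. *)
Lemma cramer_row (K : comNzRingType) n (A : 'M[K]_n) (g : 'rV_n) i :
  g 0 i * \det A = \sum_j (g *m A) 0 j * cofactor A i j.
Proof.
have /matrixP/(_ 0 i) : g *m A *m \adj A = \det A *: g.
  by rewrite -mulmxA mul_mx_adj mul_mx_scalar.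
rewrite [in RHS]mxE mxE mulrC => <-; apply: eq_bigr => j _.
by rewrite [(\adj A) _ _]mxE.
Qed.

Definition window (K : comNzRingType) (F : nat -> nat -> K) n p q : 'M[K]_n :=
  \matrix_(i, j) F (p + i)%N (q + j)%N.

Local Notation minor F n p q := (\det (window F n p q)).

Lemma cofactor_window00 (K : comNzRingType) (F : nat -> nat -> K) n p q :
  cofactor (window F n.+1 p q) 0 0 = minor F n p.+1 q.+1.
Proof.
rewrite /cofactor mul1r; congr (\det _).
by apply/matrixP => i j; rewrite !mxE /= /bump /= !add1n !addSnnS.
Qed.

Lemma cofactor_window0m (K : comNzRingType) (F : nat -> nat -> K) n p q :
  cofactor (window F n.+1 p q) 0 ord_max = (-1) ^+ n * minor F n p.+1 q.
Proof.
rewrite /cofactor add0n; congr (_ * \det _).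
by apply/matrixP => i j; rewrite !mxE lift_max /= /bump /= add1n addSnnS.
Qed.

Lemma cofactor_windowmm (K : comNzRingType) (F : nat -> nat -> K) n p q :
  cofactor (window F n.+1 p q) ord_max ord_max = minor F n p q.
Proof.
rewrite /cofactor addnn -signr_odd odd_double mul1r; congr (\det _).
by apply/matrixP => i j; rewrite !mxE !lift_max.
Qed.

(** Both deletions leave the columns [q+1, ..., q+n]; only the position signs differ. *)
Lemma cofactor_window_shift (K : comNzRingType) (F : nat -> nat -> K) n p q i :
  cofactor (window F n.+1 p q) i 0
  = (-1) ^+ n * cofactor (window F n.+1 p q.+1) i ord_max.
Proof.
rewrite /cofactor addn0 mulrA -exprD [(n + _)%N]addnC -addnA addnn.
rewrite exprD -[_ ^+ _.*2]signr_odd odd_double mulr1; congr (_ * \det _).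
by apply/matrixP => k j; rewrite !mxE lift_max /= /bump /= add1n addSnnS.
Qed.

Lemma desnanot_jacobi (K : comNzRingType) (F : nat -> nat -> K) n p q :
  minor F n.+2 p q * minor F n p.+1 q.+1
  = minor F n.+1 p q * minor F n.+1 p.+1 q.+1
    - minor F n.+1 p q.+1 * minor F n.+1 p.+1 q.
Proof.
(* [g] is the row of cofactors of the first column of the upper left block, so
   [g *m window] vanishes except at its two ends. *)
pose A0 := window F n.+1 p q.
pose w c := \sum_(i < n.+1) cofactor A0 i 0 * F (p + i)%N c.
have wE (j : 'I_n.+1) : w (q + j)%N = \det A0 *+ (0 == j).
  have /matrixP/(_ 0 j) := mul_adj_mx A0; rewrite [in RHS]mxE => <-.
  by rewrite mxE; apply: eq_bigr => i _; rewrite !mxE.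
have wm : w (q + n.+1)%N = (-1) ^+ n * minor F n.+1 p q.+1.
  rewrite (expand_det_col _ ord_max) mulr_sumr; apply: eq_bigr => i _.
  by rewrite cofactor_window_shift mxE addSnnS /= -mulrA [F _ _ * _]mulrC.
pose g := \row_(i < n.+2) if unlift ord_max i is Some k then cofactor A0 k 0 else 0.
have gA j : (g *m window F n.+2 p q) 0 j = w (q + j)%N.
  rewrite mxE big_ord_recr /= !mxE unlift_none mul0r addr0.
  apply: eq_bigr => i _; rewrite !mxE.
  have -> : widen_ord (leqnSn n.+1) i = lift ord_max i.
    by apply/val_inj; rewrite /= /bump leqNgt ltn_ord.
  by rewrite liftK lift_max.
have g0 : g 0 0 = minor F n p.+1 q.+1.
  have E : lift ord_max ord0 = 0 :> 'I_n.+2 by apply/val_inj.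
  by rewrite mxE -{1}E liftK cofactor_window00.
rewrite mulrC -g0 cramer_row big_ord_recl big_ord_recr /= big1 => [|i _].
  have -> : lift ord0 ord_max = ord_max :> 'I_n.+2 by apply/val_inj.
  rewrite !gA /= wm (wE 0) cofactor_window00 cofactor_window0m exprS add0r.
  by rewrite eqxx mulr1n; ring: (sqrr_sign K n).
have -> : lift ord0 (widen_ord (leqnSn n) i) = lift ord_max (lift ord0 i).
  by apply/ord_inj; rewrite lift_max.
by rewrite gA lift_max wE (negbTE (neq_lift _ _)) mul0r.
Qed.

Lemma left_kernel_minors (K : comNzRingType) (F : nat -> nat -> K) n p q (g : nat -> K) :
  (forall j, (j < n)%N -> \sum_(i < n.+1) g i * F (p + i)%N (q + j)%N = 0) ->
  g 0%N * minor F n p q = (-1) ^+ n * g n * minor F n p.+1 q.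
Proof.
move=> gF.
(* The window is made square by appending the unit vector of row [p + n] as last column, on which
   the relation takes the value [g n]. *)
pose G i j := if (j < q + n)%N then F i j else (i == p + n)%N%:R.
have GF p' : \det (window G n p' q) = minor F n p' q.
  by congr (\det _); apply/matrixP => i j; rewrite !mxE /G ltn_add2l ltn_ord.
have G1 : \det (window G n.+1 p q) = minor F n p q.
  rewrite (expand_det_col _ ord_max) (bigD1 ord_max) //= big1 => [|i /negP im].
    by rewrite mxE /G ltnn eqxx mul1r addr0 cofactor_windowmm GF.
  rewrite mxE /G ltnn eqn_add2l; case: eqP => [e|]; last by rewrite mul0r.
  by case: im; apply/eqP/val_inj.
have := @cramer_row _ n.+1 (window G n.+1 p q) (\row_i g i) 0.
rewrite G1 mxE => ->; rewrite big_ord_recr /= big1 ?add0r => [|j _].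
  rewrite cofactor_window0m GF mulrCA -mulrA; congr (_ * (_ * _)).
  rewrite mxE big_ord_recr /= big1 ?add0r => [|i _].
    by rewrite !mxE /G ltnn eqxx mulr1.
  by rewrite !mxE /G ltnn eqn_add2l /= ltn_eqF ?mulr0.
rewrite (_ : _ 0 _ = 0) ?mul0r //= mxE -[RHS](gF j) //.
by apply: eq_bigr => i _; rewrite !mxE /G ltn_add2l /= ltn_ord.
Qed.

(** * Boundary values and minors of the band matrix *)

Lemma Sx_mL (R : nzRingType) r l (S : nat -> nat -> int -> R) a k :
  Sx r l S a (2 * l) k = 1.
Proof. by rewrite /Sx eqxx orbT. Qed.

Lemma Sx_a0 (R : nzRingType) r l (S : nat -> nat -> int -> R) m k :
  Sx r l S 0 m k = 1.
Proof. by rewrite /Sx; case: ifP. Qed.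

Lemma Sx_aN (R : nzRingType) r l (S : nat -> nat -> int -> R) m k :
  Sx r l S (2 * r + 2) m k = (-1) ^+ m.
Proof.
rewrite /Sx addn2 /= eqxx; case: ifP => // /orP[] /eqP -> //.
by rewrite exprM sqrrN expr1n expr1n.
Qed.

Lemma Sx_middle (R : nzRingType) r l (S : nat -> nat -> int -> R) m k :
  odd m -> Sx r l S r.+1 m k = 0.
Proof.
move=> oddm; rewrite /Sx eqxx oddm /= ifN; last by lia.
by rewrite ifN //; lia.
Qed.

Lemma Sx_sym (R : comUnitRingType) r l (S : nat -> nat -> int -> R) a m k :
  Tsystem r l S -> (a <= 2 * r + 2)%N -> (m <= 2 * l)%N ->
  Sx r l S a m k = (-1) ^+ m * Sx r l S (2 * r + 2 - a) m k.
Proof.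
move=> [_ [_ sym]] aN mL.
have [->|m0] := eqVneq m 0%N; first by rewrite mul1r.
have [->|m1] := eqVneq m (2 * l)%N.
  by rewrite !Sx_mL exprM sqrrN !expr1n mul1r.
have [->|a0] := eqVneq a 0%N; first by rewrite subn0 Sx_aN Sx_a0 -expr2 sqrr_sign.
have [->|a1] := eqVneq a (2 * r + 2)%N; first by rewrite subnn Sx_aN Sx_a0 mulr1.
by apply: sym; lia.
Qed.

Lemma Sx_unit (R : comUnitRingType) r l (S : nat -> nat -> int -> R) a m k :
  Tsystem r l S -> (a <= 2 * r + 2)%N -> (m <= 2 * l)%N ->
  ~~ ((a == r.+1) && odd m) -> Sx r l S a m k \is a GRing.unit.
Proof.
move=> [unitS _] aN mL nmid.
have [->|m0] := eqVneq m 0%N; first exact: unitr1.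
have [->|m1] := eqVneq m (2 * l)%N; first by rewrite Sx_mL unitr1.
have [->|a0] := eqVneq a 0%N; first by rewrite Sx_a0 unitr1.
have [->|a1] := eqVneq a (2 * r + 2)%N.
  by rewrite Sx_aN unitrX // unitrN1.
rewrite /Sx (negbTE m0) (negbTE m1) (negbTE a0) (negbTE a1) (negbTE nmid) /=.
by apply: unitS; rewrite /gen_index nmid andbT; lia.
Qed.

(* [c] absorbs the parity and the origin of the spectral parameter, so minors with
   first row 0 already reach every [k]. *)
Definition band (R : nzRingType) r l (S : nat -> nat -> int -> R)
    (c : int) (p q : nat) : R :=
  if (p <= q <= p + (2 * r + 2))%N then Sx r l S (q - p) 1 (c + (p + q)%:Z) else 0.

Lemma minor_band_a0 (R : comNzRingType) r l (S : nat -> nat -> int -> R) c m p :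
  minor (band r l S c) m p p = 1.
Proof.
rewrite -det_tr det_trig; last first.
  by apply/is_trig_mxP => i j ij; rewrite !mxE /band leq_add2l leqNgt ij.
by rewrite big1 // => i _; rewrite !mxE /band leqnn leq_addr subnn Sx_a0.
Qed.

Lemma minor_band_aN (R : comNzRingType) r l (S : nat -> nat -> int -> R) c m p :
  minor (band r l S c) m p (p + (2 * r + 2)) = (-1) ^+ m.
Proof.
rewrite det_trig; last first.
  by apply/is_trig_mxP => i j ij; rewrite !mxE /band ifN //; lia.
rewrite (eq_bigr (fun=> -1)) ?prodr_const ?card_ord // => i _.
by rewrite !mxE /band [(p + _ + i)%N]addnAC leq_addr leqnn addKn Sx_aN.
Qed.

Lemma minor_band_middle (R : comUnitRingType) r l (S : nat -> nat -> int -> R) c m p :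
  (1 <= l)%N -> Tsystem r l S -> odd m ->
  minor (band r l S c) m p (p + r.+1) = 0.
Proof.
move=> l1 TS oddm; apply: det_alternating_odd => // [i|i j]; rewrite !mxE /band.
  rewrite (_ : (_ - _)%N = r.+1); last by lia.
  by rewrite Sx_middle // if_same.
(* Transposition replaces the index [b] of an entry by [2r+2-b] and keeps its spectral parameter, so
   quasi-symmetry at [m = 1] applies. *)
have -> : (p + j <= p + r.+1 + i <= p + j + (2 * r + 2))%N
        = (p + i <= p + r.+1 + j <= p + i + (2 * r + 2))%N by lia.
case: ifP => [ij|_]; last by rewrite oppr0.
rewrite (Sx_sym _ TS) ?expr1 ?mulN1r; [congr (- Sx _ _ _ _ _ _)| |]; lia.
Qed.

(** For [m > 0] the parameter, less [c], is the mean of row plus column index over the two ends of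
    the window's diagonal. *)
Lemma Sx_eq_minor (R : comUnitRingType) r l (S : nat -> nat -> int -> R) a m p c :
  (1 <= l)%N -> Tsystem r l S -> (a <= 2 * r + 2)%N -> (m <= 2 * l)%N ->
  minor (band r l S c) m p (p + a) = Sx r l S a m (c + (2 * p + a + m)%:Z - 1).
Proof.
move=> l1 TS; elim/ltn_ind: m a p c => -[|[|m]] IH a p c aN mL.
- by rewrite det_mx00.
- rewrite det_mx11 mxE /band !addn0 leq_addr leq_add2l aN addKn.
  by congr (Sx _ _ _ _ _ _); lia.
have [->|a0] := eqVneq a 0%N; first by rewrite addn0 minor_band_a0 Sx_a0.
have [->|a1] := eqVneq a (2 * r + 2)%N; first by rewrite minor_band_aN Sx_aN.
have [/andP[/eqP-> ?]|nmid] := boolP ((a == r.+1) && odd m).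
  by rewrite minor_band_middle ?Sx_middle //= negbK.
set k := _ - 1.
have DJ := desnanot_jacobi (band r l S c) m p (p + a).
(* In Desnanot-Jacobi the diagonal neighbours keep the offset [a]; the other two have offsets [a.+1]
   and [a.-1]. *)
have e1 : ((p + a).+1 = p.+1 + a)%N by lia.
have e2 : ((p + a).+1 = p + a.+1)%N by lia.
have e3 : ((p + a) = p.+1 + a.-1)%N by lia.
move: DJ; rewrite {1 2}e1 e2 {3}e3 !(IH m.+1 (ltnSn _)) ?(IH m (leqW (ltnSn m)));
  try by lia.
rewrite [X in _ = _ * X - _](_ : _ = Sx r l S a m.+1 (k + 1)); last first.
  by congr (Sx _ _ _ _ _ _); lia.
rewrite [X in _ = X * _ - _](_ : _ = Sx r l S a m.+1 (k - 1)); last first.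
  by congr (Sx _ _ _ _ _ _); lia.
rewrite [X in _ = _ - X * _](_ : _ = Sx r l S a.+1 m.+1 k); last first.
  by congr (Sx _ _ _ _ _ _); lia.
rewrite [X in _ = _ - _ * X](_ : _ = Sx r l S a.-1 m.+1 k); last first.
  by congr (Sx _ _ _ _ _ _); lia.
rewrite [X in _ * X = _](_ : _ = Sx r l S a m k); last first.
  by congr (Sx _ _ _ _ _ _); lia.
have [_ [rec _]] := TS; rewrite rec; [|lia|lia].
rewrite [Sx _ _ _ a.-1 _ _ * _]mulrC addrK [RHS]mulrC => /mulIr; apply.
by apply: Sx_unit => //; lia.
Qed.

(** The right side of Desnanot-Jacobi is [1 - 1], and the inner minor, of size [2l-1], is a unit
    unless [a = r.+1]; there the odd size [2l+1] suffices. *)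
Lemma minor_band_vanish (R : comUnitRingType) r l (S : nat -> nat -> int -> R) a p c :
  (1 <= l)%N -> Tsystem r l S -> (0 < a < 2 * r + 2)%N ->
  minor (band r l S c) (2 * l).+1 p (p + a) = 0.
Proof.
move=> l1 TS aN.
have [->|amid] := eqVneq a r.+1; first by rewrite minor_band_middle //; lia.
have := desnanot_jacobi (band r l S c) (2 * l).-1 p (p + a).
have e1 : ((p + a).+1 = p.+1 + a)%N by lia.
have e2 : ((p + a).+1 = p + a.+1)%N by lia.
have e3 : ((p + a) = p.+1 + a.-1)%N by lia.
rewrite prednK; last by lia.
rewrite {1 2}e1 e2 {3}e3 !(@Sx_eq_minor _ r l _ _ (2 * l))
  ?(@Sx_eq_minor _ r l _ _ (2 * l).-1) //; try by lia.
rewrite !Sx_mL subrr => /(canRL (mulrK _)) ->; first by rewrite mul0r.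
by apply: Sx_unit => //; lia.
Qed.

(** * The row relation and half-periodicity *)

Lemma band_kernel (R : comUnitRingType) r l (S : nat -> nat -> int -> R) c :
  (1 <= l)%N -> (1 <= r)%N -> Tsystem r l S ->
  exists g : nat -> R, g (2 * l)%N = 1 /\
    forall q, (0 < q < 2 * l + 2 * r + 2)%N ->
      \sum_(0 <= s < (2 * l).+1) g s * band r l S c s q = 0.
Proof.
move=> l1 r1 TS; pose B := band r l S c; pose W a := window B (2 * l).+1 0 a.
(* Cofactors of the last column of the first singular window: they annihilate all of its columns,
   [1] to [2l+1]. *)
pose g s := cofactor (W 1%N) (inord s) ord_max; exists g.
have g1 : g (2 * l)%N = 1.
  rewrite /g (_ : inord _ = ord_max); last by apply/ord_inj; rewrite inordK.
  by rewrite cofactor_windowmm -[1%N]add0n Sx_eq_minor ?Sx_mL //; lia.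
split=> //; elim/ltn_ind => q IH qN; rewrite big_mkord.
have [qL|qL] := leqP q (2 * l).+1.
  have jP : (q.-1 < (2 * l).+1)%N by lia.
  have /matrixP/(_ ord_max (Ordinal jP)) := mul_adj_mx (W 1%N).
  rewrite [in RHS]mxE (_ : \det _ = 0) ?mul0rn; last first.
    by rewrite /W -[1%N]add0n minor_band_vanish //; lia.
  move=> E; rewrite -[RHS]E [in RHS]mxE; apply: eq_bigr => s _.
  by rewrite !mxE /g inord_val add0n add1n prednK //; lia.
(* Column [q] is the last of the singular window at offset [a]. The earlier columns are annihilated
   by induction, and the corner cofactor is [S^(a)_{2l} = 1]. *)
pose a := (q - 2 * l)%N.
have qa : q = (a + 2 * l)%N by rewrite subnK //; lia.
have := cramer_row (W a) (\row_s g s) ord_max.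
have -> : \det (W a) = 0 by rewrite /W -[a]add0n minor_band_vanish //; lia.
have gW (j : 'I_(2 * l).+1) :
    (\row_s g s *m W a) 0 j = \sum_(s < (2 * l).+1) g s * B s (a + j)%N.
  by rewrite mxE; apply: eq_bigr => s _; rewrite !mxE.
rewrite mulr0 big_ord_recr big1 => [|j _] /=.
  rewrite add0r cofactor_windowmm -{2}[a]add0n Sx_eq_minor //; try by lia.
  by rewrite Sx_mL mulr1 gW -qa.
have jL := ltn_ord j; have := IH (a + j)%N; rewrite gW big_mkord => -> //; last by lia.
  by rewrite mul0r.
by lia.
Qed.

Lemma Sx1_half_period (R : comUnitRingType) r l (S : nat -> nat -> int -> R) m k :
  (1 <= l)%N -> (1 <= r)%N -> Tsystem r l S -> (m <= 2 * l)%N ->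
  Sx r l S 1 (2 * l - m) k = Sx r l S 1 m (k + (2 * (r + 1 + l))%:Z).
Proof.
move=> l1 r1 TS mL; pose c := k - (2 * l - m)%:Z; pose B := band r l S c.
have [g [gL gB]] := band_kernel c l1 r1 TS.
(* On columns [1..n] the rows below row [n] vanish, which truncates the relation to rows [0..n]. *)
have head n : (n <= 2 * l)%N -> g 0%N * Sx r l S 1 n (c + n%:Z) = (-1) ^+ n * g n.
  move=> nL; have := @left_kernel_minors _ B n 0 1 g.
  rewrite minor_band_a0 -{1}[1%N]add0n Sx_eq_minor //; try by lia.
  rewrite mulr1 (_ : _ - 1 = c + n%:Z); last by lia.
  apply=> j jn; rewrite -[RHS](gB j.+1); last by lia.
  rewrite -(big_mkord xpredT (fun i => g i * B (0 + i)%N (1 + j)%N)).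
  rewrite [in RHS](@big_cat_nat _ _ _ n.+1) //=.
  rewrite [X in _ = _ + X]big_nat_cond [X in _ = _ + X]big1 ?addr0 // => i ni.
  by rewrite /band ifN ?mulr0 //; lia.
have g0 : g 0%N = 1.
  by have := head _ (leqnn _); rewrite Sx_mL gL !mulr1 exprM sqrrN !expr1n.
have sumE (f : nat -> R) :
    \sum_(2 * l - m <= i < (2 * l).+1) f i = \sum_(i < m.+1) f (2 * l - m + i)%N.
  rewrite -{1}[(2 * l - m)%N]add0n big_addn subSn ?leq_subr // subKn // big_mkord.
  by apply: eq_bigr => i _; rewrite addnC.
(* On the last [m] columns the band width leaves only rows [2l-m..2l]. *)
have tail : g (2 * l - m)%N = Sx r l S (2 * r + 1) m (k + (2 * (r + 1 + l))%:Z).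
  have := @left_kernel_minors _ B m (2 * l - m) (2 * l - m + (2 * r + 2))
    (fun i => g (2 * l - m + i)%N).
  rewrite minor_band_aN addn0 subnK // gL mulr1 mulrC.
  rewrite (_ : (2 * l - m + _ = (2 * l - m).+1 + (2 * r + 1))%N); last by lia.
  rewrite Sx_eq_minor //; try by lia.
  rewrite (_ : _ - 1 = k + (2 * (r + 1 + l))%:Z); last by lia.
  move=> E; apply: (can_inj (signrMK m)); apply: E => j jm.
  pose q := (2 * l - m + (2 * r + 2) + j)%N.
  rewrite -[RHS](gB q); last by rewrite /q; lia.
  rewrite [RHS](@big_cat_nat _ _ _ (2 * l - m)) /=; [|by lia|by lia].
  rewrite [X in _ = X + _]big_nat_cond [X in _ = X + _]big1 ?add0r => [|i im].
    by rewrite sumE; apply: eq_bigr => i _; congr (_ * B _ _); rewrite /q; lia.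
  by rewrite /band ifN ?mulr0 // /q; lia.
have := head _ (leq_subr m (2 * l)).
rewrite g0 mul1r subrK tail => ->.
rewrite [in RHS](Sx_sym _ TS); try by lia.
rewrite (_ : (2 * r + 2 - 1 = 2 * r + 1)%N); last by lia.
by congr (_ * _); rewrite -signr_odd oddB // mul2n odd_double /= signr_odd.
Qed.

Lemma Sx_half_period (R : comUnitRingType) r l (S : nat -> nat -> int -> R) a m k :
  (1 <= l)%N -> (1 <= r)%N -> Tsystem r l S ->
  (a <= 2 * r + 2)%N -> (m <= 2 * l)%N ->
  Sx r l S a (2 * l - m) k = Sx r l S a m (k + (2 * (r + 1 + l))%:Z).
Proof.
move=> l1 r1 TS.
have low : forall b, (b <= r.+1)%N -> forall n j, (n <= 2 * l)%N ->
    Sx r l S b (2 * l - n) j = Sx r l S b n (j + (2 * (r + 1 + l))%:Z).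
  elim/ltn_ind => -[|[|b]] IH br n j nL; first by rewrite !Sx_a0.
    exact: Sx1_half_period.
  have [->|n0] := eqVneq n 0%N; first by rewrite subn0 Sx_mL.
  have [->|n1] := eqVneq n (2 * l)%N; first by rewrite subnn Sx_mL.
  have [_ [rec _]] := TS.
  have recl := rec b.+1 (2 * l - n)%N j ltac:(lia) ltac:(lia).
  have recr := rec b.+1 n (j + (2 * (r + 1 + l))%:Z) ltac:(lia) ltac:(lia).
  have e1 : ((2 * l - n).-1 = 2 * l - n.+1)%N by lia.
  have e2 : ((2 * l - n).+1 = 2 * l - n.-1)%N by lia.
  (* Reflection swaps the two [m]-neighbours, so the two relations differ only in the [b.+2] factor;
     its cofactor has index [b < r], hence is a unit. *)
  move: recl; rewrite e1 e2 /= !(IH b.+1) ?(IH b) //; try by lia.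
  rewrite ![_ + (2 * _)%:Z]addrAC recr /= [X in _ = X + _]mulrC.
  move=> /addrI/esym/mulrI; apply.
  by apply: Sx_unit => //; lia.
move=> aN mL; have [|ar] := leqP a r.+1; first by move=> /low->.
rewrite (Sx_sym _ TS) // ?leq_subr // [RHS](Sx_sym _ TS) // low //; last by lia.
by congr (_ * _); rewrite -signr_odd oddB // mul2n odd_double /= signr_odd.
Qed.

Theorem theorem6p9 (R : comUnitRingType) (r l : nat) (S : nat -> nat -> int -> R) :
  (2 <= r)%N -> (2 <= l)%N -> Tsystem r l S ->
  forall (a m : nat) (k : int),
    (1 <= a <= 2 * r + 1)%N -> (1 <= m <= 2 * l - 1)%N ->
    (Sx r l S a m (k + 2 * (r + 1 + l)%:Z) = (-1) ^+ m * Sx r l S (2 * r + 2 - a) (2 * l - m) k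
     /\ (-1) ^+ m * Sx r l S (2 * r + 2 - a) (2 * l - m) k = Sx r l S a (2 * l - m) k)
    /\ Sx r l S a m (k + 4 * (r + 1 + l)%:Z) = Sx r l S a m k.
Proof.
move=> r2 l2 TS a m k aN mL.
have half n j : (n <= 2 * l)%N ->
    Sx r l S a n (j + 2 * (r + 1 + l)%:Z) = Sx r l S a (2 * l - n) j.
  by move=> nL; rewrite Sx_half_period //; lia.
have sym : (-1) ^+ m * Sx r l S (2 * r + 2 - a) (2 * l - m) k = Sx r l S a (2 * l - m) k.
  rewrite [RHS](Sx_sym _ TS); [|by lia|by lia].
  by congr (_ * _); rewrite -[RHS]signr_odd oddB ?mul2n ?odd_double ?signr_odd //; lia.
rewrite sym half; last by lia.
rewrite (_ : k + 4 * _ = k + 2 * (r + 1 + l)%:Z + 2 * (r + 1 + l)%:Z); last by lia.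
by rewrite !half ?subKn //; lia.
Qed.
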